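(* Let $\mathscr{P}$ be a primitive orthoplicial Apollonian packing and let $\mathscr{B}=\mathscr{B}(\mathscr{P})$ be its set of bends. Then there is always a local obstruction modulo 4: there exists $\varepsilon=\varepsilon(\mathscr{P})\in\{\pm1\}$ such that, for every $b\in\mathscr{B}$, $$b\not\equiv-\varepsilon\pmod 4 .$$ Moreover, for any orthoplicial Platonic configuration $\mathscr{V}$ in $\mathscr{P}$, the ordered set of bends $b_k=b(S_k)$ of the constituent spheres of $\mathscr{V}$ satisfies $$(b_1,b_2,b_3,b_4,b_5,b_6,b_7,b_8)\equiv(0,0,\varepsilon,\varepsilon,2,2,\varepsilon,\varepsilon)\pmod 4$$ up to reordering by the permuting action of the orthoplicial Platonic group (that is, after passing to a suitable admissible ordering of $\mathscr{V}$).
   Context: Work in $\hat{\mathbb{R}}^3=\mathbb{R}^3\cup\{\infty\}$. A ''sphere'' $S$ means a Euclidean sphere, or a plane (with $\infty$ added), together with a choice of orienting region $B$, one of the two components of its complement. Its bend $b(S)$ is $1/r$ if $S$ is a Euclidean sphere of radius $r$ and $B$ is the ball, $-1/r$ if $B$ is the exterior of the ball, and $0$ if $S$ is a plane. Möbius transformations of $\hat{\mathbb{R}}^3$ (all conformal and anti-conformal transformations) act on oriented spheres by mapping $(S,B)$ to its image. The standard configuration $\mathscr{V}_0=(S_1,\dots,S_8)$ consists of: the plane $S_1=\{z=1\}$ oriented by $\{z>1\}$; the plane $S_2=\{z=-1\}$ oriented by $\{z<-1\}$; the unit spheres $S_3,S_4,S_7,S_8$ with centers $(\sqrt2,0,0),(0,\sqrt2,0),(-\sqrt2,0,0),(0,-\sqrt2,0)$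 respectively; and the spheres $S_5,S_6$ of radius $1/2$ with centers $(0,0,-\tfrac12),(0,0,\tfrac12)$ respectively; $S_3,\dots,S_8$ are oriented by the balls they bound. An orthoplicial Platonic configuration is the image of $\mathscr{V}_0$ under a Möbius transformation. An ordering $S_1,\dots,S_8$ of its spheres is admissible if distinct $S_i,S_j$ are tangent when $i\not\equiv j \pmod 4$ and disjoint when $i\equiv j\pmod 4$. The orthoplicial Platonic group is the full symmetry group (of order 384) of the 4-orthoplex; it permutes the eight spheres preserving tangency and acts simply transitively on the 384 admissible orderings. Each configuration $\mathscr{V}$ contains 16 quadruples $\mathscr{F}$ of pairwise tangent spheres; each has a unique dual sphere $S(\mathscr{F})$ orthogonal to its four members, and inverting $\mathscr{V}$ in $S(\mathscr{F})$ gives another orthoplicial configuration. An orthoplicial Apollonian packing $\mathscr{P}$ is the set of all spheres appearing in the family of configurations obtained from one configuration by successively applying all these inversions (to each configuration so obtained); the members of this family are the configurations ''in $\mathscr{P}$''. Let $\mathscr{B}(\mathscr{P})=\{b(S): S\in\mathscr{P}\}$. $\mathscr{P}$ is integral if $\mathscr{B}(\mathscr{P})\subset\mathbb{Z}$, and primitive if it is integral and $\gcd\mathscr{B}(\mathscr{P})=1$. *)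

(* Defs.v *)
From HB Require Import structures.
From mathcomp Require Import all_boot all_order all_algebra.
From mathcomp Require Import boolp classical_sets reals.
From mathcomp Require Import ring lra.

Set Implicit Arguments.
Unset Strict Implicit.
Unset Printing Implicit Defensive.

Import Order.TTheory GRing.Theory Num.Theory.
Local Open Scope classical_set_scope.
Local Open Scope ring_scope.

(* R^3 with a point at infinity: [Some x] is a finite point, [None] is oo.
   Euclidean lengths are written with [dot]: the norm that mathcomp-analysis
   puts on 'rV[R]_3 is the sup norm. *)
Definition point (R : realType) : Type := option 'rV[R]_3.

Definition vec3 (R : realType) (x y z : R) : 'rV[R]_3 :=
  \row_(k < 3) tnth [tuple x; y; z] k.

Definition dot (R : realType) (u v : 'rV[R]_3) : R := \sum_i u 0 i * v 0 i.

Definition dist2 (R : realType) (x y : 'rV[R]_3) : R := dot (x - y) (x - y).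

Definition round (R : realType) (c : 'rV[R]_3) (r : R) : set (point R) :=
  [set p | if p is Some x then dist2 x c = r ^+ 2 else False].

Definition inner (R : realType) (c : 'rV[R]_3) (r : R) : set (point R) :=
  [set p | if p is Some x then dist2 x c < r ^+ 2 else False].

Definition outer (R : realType) (c : 'rV[R]_3) (r : R) : set (point R) :=
  [set p | if p is Some x then r ^+ 2 < dist2 x c else True].

Definition plane (R : realType) (n : 'rV[R]_3) (d : R) : set (point R) :=
  [set p | if p is Some x then dot n x = d else True].

(* The other side of [plane n d] is [halfspace (- n) (- d)]. *)
Definition halfspace (R : realType) (n : 'rV[R]_3) (d : R) : set (point R) :=
  [set p | if p is Some x then d < dot n x else False].

(* A pair (S, B) of a point set and an orienting region.  The pairs which
   really are oriented spheres are those satisfying [has_bend] for some bend. *)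
Definition osphere (R : realType) : Type := (set (point R) * set (point R))%type.

Inductive has_bend (R : realType) : osphere R -> R -> Prop :=
| has_bend_inner c r : 0 < r -> has_bend (round c r, inner c r) r^-1
| has_bend_outer c r : 0 < r -> has_bend (round c r, outer c r) (- r^-1)
| has_bend_plane n d : n != 0 -> has_bend (plane n d, halfspace n d) 0.

(* The value is the default 0 on pairs that are not oriented spheres; see
   [bendP] below. *)
Definition bend (R : realType) (X : osphere R) : R := xget 0 [set b | has_bend X b].

Definition invert_round (R : realType) (c : 'rV[R]_3) (r : R) (p : point R) : point R :=
  match p with
  | Some x => if x == c then None else Some (c + (r ^+ 2 / dist2 x c) *: (x - c))
  | None => Some c
  end.

Definition reflect_plane (R : realType) (n : 'rV[R]_3) (d : R) (p : point R) : point R :=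
  match p with
  | Some x => Some (x - (2 * (dot n x - d) / dot n n) *: n)
  | None => None
  end.

Inductive inversion_in (R : realType) : set (point R) -> (point R -> point R) -> Prop :=
| inversion_round c r : 0 < r -> inversion_in (round c r) (invert_round c r)
| inversion_plane n d : n != 0 -> inversion_in (plane n d) (reflect_plane n d).

(* The full Moebius group, orientation-reversing maps included, as the group
   generated by the inversions (each of which is its own inverse). *)
Inductive moebius (R : realType) : (point R -> point R) -> Prop :=
| moebius_id : moebius id
| moebius_comp D f g : inversion_in D f -> moebius g -> moebius (f \o g).

Definition act (R : realType) (f : point R -> point R) (X : osphere R) : osphere R :=
  (f @` X.1, f @` X.2).

(* For two round spheres or planes, meeting in exactly one point, possibly oo. *)
Definition tangent (R : realType) (X Y : osphere R) : Prop :=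
  exists p, X.1 `&` Y.1 = [set p].

Definition disjoint_spheres (R : realType) (X Y : osphere R) : Prop :=
  X.1 `&` Y.1 = set0.

Inductive normal_at (R : realType) : set (point R) -> 'rV[R]_3 -> 'rV[R]_3 -> Prop :=
| normal_round c r x : 0 < r -> round c r (Some x) -> normal_at (round c r) x (x - c)
| normal_plane n d x : n != 0 -> plane n d (Some x) -> normal_at (plane n d) x n.

(* Orthogonal round spheres or planes always share finite points, whereas
   parallel planes meet only at oo and must be excluded. *)
Definition orthogonal (R : realType) (S T : set (point R)) : Prop :=
  (exists x, S (Some x) /\ T (Some x)) /\
  forall x u v, normal_at S x u -> normal_at T x v -> dot u v = 0.

Definition oball (R : realType) (c : 'rV[R]_3) (r : R) : osphere R :=
  (round c r, inner c r).

Definition ohalfspace (R : realType) (n : 'rV[R]_3) (d : R) : osphere R :=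
  (plane n d, halfspace n d).

(* Indices are shifted by one: [standard R k] is the sphere S_(k+1). *)
Definition standard (R : realType) (k : 'I_8) : osphere R :=
  tnth [tuple
    ohalfspace (vec3 0 0 1) 1;
    ohalfspace (vec3 0 0 (-1)) 1;
    oball (vec3 (Num.sqrt 2) 0 0) 1;
    oball (vec3 0 (Num.sqrt 2) 0) 1;
    oball (vec3 0 0 (- (1 / 2))) (1 / 2);
    oball (vec3 0 0 (1 / 2)) (1 / 2);
    oball (vec3 (- Num.sqrt 2) 0 0) 1;
    oball (vec3 0 (- Num.sqrt 2) 0) 1] k.

Definition platonic (R : realType) (V : set (osphere R)) : Prop :=
  exists f, moebius f /\ V = act f @` range (@standard R).

(* The condition on i and j is insensitive to the shift of indices by one. *)
Definition admissible_ordering (R : realType)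
    (V : set (osphere R)) (s : 'I_8 -> osphere R) : Prop :=
  [/\ injective s, range s = V &
      forall i j : 'I_8, i != j ->
        if i == j %[mod 4] then disjoint_spheres (s i) (s j)
        else tangent (s i) (s j)].

Definition tangent_quadruple (R : realType)
    (V : set (osphere R)) (q : 'I_4 -> osphere R) : Prop :=
  (forall i, V (q i)) /\ forall i j : 'I_4, i != j -> tangent (q i) (q j).

Definition dual_inversion (R : realType)
    (V : set (osphere R)) (f : point R -> point R) : Prop :=
  exists q D, [/\ tangent_quadruple V q, inversion_in D f &
                  forall i, orthogonal D (q i).1].

Inductive family (R : realType) (V : set (osphere R)) : set (osphere R) -> Prop :=
| family_start : family V V
| family_invert W f : family V W -> dual_inversion W f -> family V (act f @` W).

Definition packing (R : realType) (V : set (osphere R)) : set (osphere R) :=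
  [set X | exists2 W, family V W & W X].

Definition is_packing (R : realType) (P : set (osphere R)) : Prop :=
  exists2 V, platonic V & P = packing V.

(* Refers to every family that generates P. *)
Definition configuration_in (R : realType) (P V : set (osphere R)) : Prop :=
  exists W, [/\ platonic W, P = packing W & family W V].

Definition bends (R : realType) (P : set (osphere R)) : set R := bend (R := R) @` P.

Definition integral (R : realType) (P : set (osphere R)) : Prop :=
  forall b, bends P b -> exists z : int, b = z%:~R.

Definition is_gcd (A : set int) (g : nat) : Prop :=
  (forall z, A z -> (g%:Z %| z)%Z) /\
  forall d : nat, (forall z, A z -> (d%:Z %| z)%Z) -> (d %| g)%N.

Definition primitive (R : realType) (P : set (osphere R)) : Prop :=
  integral P /\ is_gcd [set z : int | bends P z%:~R] 1.

Lemma dotDl (R : realType) (u v w : 'rV[R]_3) : dot (u + v) w = dot u w + dot v w.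
Proof. by rewrite /dot -big_split /=; apply: eq_bigr => i _; rewrite mxE mulrDl. Qed.

Lemma dotC (R : realType) (u v : 'rV[R]_3) : dot u v = dot v u.
Proof. by apply: eq_bigr => i _; rewrite mulrC. Qed.

Lemma dotZl (R : realType) a (u v : 'rV[R]_3) : dot (a *: u) v = a * dot u v.
Proof. by rewrite /dot mulr_sumr; apply: eq_bigr => i _; rewrite mxE mulrA. Qed.

Lemma dot_ge0 (R : realType) (u : 'rV[R]_3) : 0 <= dot u u.
Proof. by apply: sumr_ge0 => i _; rewrite -expr2 sqr_ge0. Qed.

Lemma round_radius_le (R : realType) (c c' : 'rV[R]_3) (r r' : R) :
  0 < r -> 0 < r' -> round c r = round c' r' -> r <= r'.
Proof.
move=> r0 r'0 E; pose e : 'rV[R]_3 := vec3 1 0 0.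
have ee : dot e e = 1 by rewrite /dot !big_ord_recl big_ord0 !mxE !(tnth_nth 0) /= !mulr0 !addr0 mulr1.
have on a : a ^+ 2 = r ^+ 2 -> dot (c - c' + a *: e) (c - c' + a *: e) = r' ^+ 2.
  move=> ha; have : round c r (Some (c + a *: e)).
    by rewrite /round /= /dist2 addrC addKr dotZl dotC dotZl ee mulr1 -expr2.
  by rewrite E /round /= /dist2 addrAC.
have dd := dot_ge0 (c - c').
have := on (- r) (sqrrN r); have := on r erefl.
move: (c - c') dd => d dd.
rewrite !dotDl !(dotC _ (_ + _)) !dotDl !dotZl !(dotC _ (_ *: _)) !dotZl ee.
rewrite (dotC e d) => h1 h2.
have {h1 h2 dd} : r ^+ 2 <= r' ^+ 2 by lra.
by rewrite ler_pXn2r // nnegrE ltW.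
Qed.

Lemma has_bend_uniq (R : realType) (X : osphere R) b b' :
  has_bend X b -> has_bend X b' -> b = b'.
Proof.
have radius (c c' : 'rV[R]_3) r r' :
    0 < r -> 0 < r' -> round c r = round c' r' -> r = r'.
  move=> r0 r'0 E; apply/eqP; rewrite eq_le.
  by rewrite (round_radius_le r0 r'0 E) (round_radius_le r'0 r0 (esym E)).
have no (A B : set (point R)) : A = B -> A None -> ~ B None -> False.
  by move=> -> ? /(_ _); apply.
case=> [c r r0|c r r0|n d n0] H; inversion H as [c' r' r'0 [E F]|c' r' r'0 [E F]|n' d' n'0 [E F]] => //.
- by rewrite (radius _ _ _ _ r'0 r0 E).
- by case: (no _ _ F) => //=; case.
- by case: (no _ _ E) => //=; case.
- by case: (no _ _ (esym F)) => //=; case.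
- by rewrite (radius _ _ _ _ r'0 r0 E).
- by case: (no _ _ E) => //=; case.
- by case: (no _ _ (esym E)) => //=; case.
- by case: (no _ _ (esym E)) => //=; case.
Qed.

Lemma bendP (R : realType) (X : osphere R) b : has_bend X b -> bend X = b.
Proof.
by move=> Xb; apply: xget_unique => // b' Xb'; apply: has_bend_uniq Xb' Xb.
Qed.

(* Main.v *)
(* The sphere with bend b, co-bend a and bend-times-center u is the unit vector
   (b, a, u) of the Lorentz space R^5 with form u.u' - (b a' + a b') / 2; points
   are null vectors and inversions act as reflections, so the bends of a
   configuration are the products <N, v_k> of one null vector N with the eight
   standard vectors. Hence antipodal bends have a constant sum s, and twice the sum
   of the four products of antipodal bends is s^2.

   When the bends are integers, s = 2m is even, and modulo 8 the quadratic relation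
   leaves only two possibilities: all bends are even, or they are
   (0,0,eps,eps,2,2,eps,eps) modulo 4 up to reordering. Inverting in a dual sphere
   fixes one bend of each antipodal pair and changes m to another root of the same
   quadratic relation, with the same parity, so the residues modulo 4 of all eight
   bends are constant along the packing; primitivity then excludes the even case. *)

Require Import Defs.
From mathcomp Require Import all_boot all_order all_algebra.
From mathcomp Require Import boolp classical_sets reals.
From mathcomp Require Import ring lra zify.

Import Order.TTheory GRing.Theory Num.Theory.
Local Open Scope classical_set_scope.
Local Open Scope ring_scope.

Set Implicit Arguments.
Unset Strict Implicit.
Unset Printing Implicit Defensive.

Section Dot.
Variable R : realType.
Implicit Types u v w : 'rV[R]_3.

Lemma dotDr u v w : dot u (v + w) = dot u v + dot u w.
Proof. by rewrite dotC dotDl !(dotC _ u). Qed.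

Lemma dotZr a u v : dot u (a *: v) = a * dot u v.
Proof. by rewrite dotC dotZl dotC. Qed.

Lemma dotNl u v : dot (- u) v = - dot u v.
Proof. by rewrite -scaleN1r dotZl mulN1r. Qed.

Lemma dotNr u v : dot u (- v) = - dot u v.
Proof. by rewrite dotC dotNl dotC. Qed.

Lemma dot0r u : dot u 0 = 0.
Proof. by rewrite -(scale0r u) dotZr mul0r. Qed.

Lemma dot0l u : dot 0 u = 0.
Proof. by rewrite dotC dot0r. Qed.

Lemma dot_eq0 u : (dot u u == 0) = (u == 0).
Proof.
apply/eqP/eqP => [/eqP|->]; last exact: dot0r.
rewrite psumr_eq0 => [/allP h|i _]; last by rewrite -expr2 sqr_ge0.
apply/rowP => i; have := h i (mem_index_enum i).
by rewrite /= -expr2 sqrf_eq0 mxE => /eqP.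
Qed.

Definition dotE := (dotDl, dotDr, dotNl, dotNr, dotZl, dotZr).

End Dot.

Local Notation lorentz R := (R * R * 'rV[R]_3)%type.

(** * Lorentz form, and inversions as reflections *)

Section Lorentz.
Variable R : realType.
Implicit Types (v w d : lorentz R) (p : Defs.point R).

Definition lform v w : R :=
  dot v.2 w.2 - (v.1.1 * w.1.2 + v.1.2 * w.1.1) / 2.

Lemma lformC v w : lform v w = lform w v.
Proof. by rewrite /lform dotC; ring. Qed.

(* [R] is a module over itself only under its alias [R^o], so the pair type has
   no canonical scaling. *)
Definition lscale (k : R) v : lorentz R := (k * v.1.1, k * v.1.2, k *: v.2).

Lemma lformDl v v' w : lform (v + v') w = lform v w + lform v' w.
Proof. by rewrite /lform /= dotDl; ring. Qed.

Lemma lformZl k v w : lform (lscale k v) w = k * lform v w.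
Proof. by rewrite /lform /= dotZl ; ring. Qed.

Lemma lformDr w v v' : lform w (v + v') = lform w v + lform w v'.
Proof. by rewrite lformC lformDl !(lformC w). Qed.

Lemma lformZr w k v : lform w (lscale k v) = k * lform w v.
Proof. by rewrite lformC lformZl lformC. Qed.

Definition light (p : Defs.point R) : lorentz R :=
  if p is Some x then (1, dot x x, x) else (0, 1, 0).

(** For [v] = (b, a, u) the form at a finite x is -(b|x|^2 - 2 u.x + a)/2 and at infinity -b/2, so
    its zero set is a sphere or plane and its sign selects the orienting region. *)
Definition osph v : osphere R :=
  ([set p | lform v (light p) = 0], [set p | 0 < lform v (light p)]).

Definition refl d v : lorentz R := v + lscale (- (2 * lform v d / lform d d)) d.

Lemma refl_form d v w : lform d d != 0 -> lform (refl d v) (refl d w) = lform v w.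
Proof.
move=> d0; rewrite /refl !(lformDl, lformDr, lformZl, lformZr).
by rewrite (lformC d w); field.
Qed.

Lemma refl_adj d v w : lform v (refl d w) = lform (refl d v) w.
Proof.
rewrite /refl !(lformDl, lformDr, lformZl, lformZr) (lformC d w); ring.
Qed.

Lemma refl_fix d v : lform v d = 0 -> refl d v = v.
Proof.
move=> h; rewrite /refl h mulr0 mul0r oppr0 /lscale !mul0r scale0r.
exact: (addr0 v).
Qed.

Lemma lorentz_eq v w : v.1.1 = w.1.1 -> v.1.2 = w.1.2 -> v.2 = w.2 -> v = w.
Proof. by case: v w => [[? ?] ?] [[? ?] ?] /= -> -> ->. Qed.

(** Positivity of [k] is what makes [f] respect orienting regions as well as point sets. *)
Lemma inversion_light D f : inversion_in D f ->
  exists d, [/\ 0 < lform d d, D = (osph d).1, involutive f,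
    forall p, exists2 k, 0 < k & light (f p) = lscale k (refl d (light p)) &
    forall x, D (Some x) ->
      exists2 k, k != 0 & normal_at D x (k *: (d.2 - d.1.1 *: x))].
Proof.
case=> [c r r0|n e n0].
  have rn0 : r != 0 by rewrite gt_eqF.
  have r2 : r ^+ 2 != 0 by rewrite expf_neq0.
  (* This is r times the unit vector of the sphere; [refl] does not depend on the scale. *)
  pose d : lorentz R := (1, dot c c - r ^+ 2, c).
  have dd : lform d d = r ^+ 2 by rewrite /lform /=; field.
  exists d; rewrite dd; split.
  - by rewrite exprn_gt0.
  - apply/seteqP; split=> -[x|] //=; rewrite /lform /= /dist2 ?dotE ?(dotC x c); try lra.
    by rewrite dot0r; lra.
  - case=> [x|] /=; last by rewrite eqxx.
    case: eqVneq => [->//|xc] /=.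
    have y0 : dot (x - c) (x - c) != 0 by rewrite dot_eq0 subr_eq0.
    rewrite /dist2 addrC -subr_eq0 addrK scaler_eq0 subr_eq0 (negPf xc) orbF.
    rewrite mulf_eq0 invr_eq0 (negPf r2) (negPf y0) /=; congr Some.
    transitivity (c + 1 *: (x - c)); last by rewrite scale1r addrC subrK.
    by rewrite dotZl dotZr scalerA; congr (_ + _ *: _); field; rewrite rn0 y0.
  - case=> [x|]; last first.
      exists (r ^+ 2); first by rewrite exprn_gt0.
      rewrite /refl dd /lform /lscale /= dot0l.
      apply: lorentz_eq => /=.
      + by field.
      + by field.
      + by rewrite add0r scalerA -[LHS]scale1r; congr (_ *: _); field.
    rewrite /=; case: eqVneq => [->|xc].
      exists (r ^-2); first by rewrite invr_gt0 exprn_gt0.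
      rewrite /refl dd /lform /lscale /=; apply: lorentz_eq => /=; try by field.
      rewrite -[X in X + _]scale1r -scalerDl scalerA -[LHS](scale0r c).
      by congr (_ *: _); field.
    have [y xE] : exists y, x = c + y by exists (x - c); rewrite addrC subrK.
    have cyc : c + y - c = y by rewrite addrC addKr.
    move: xc; rewrite {x}xE -subr_eq0 cyc -dot_eq0 => y0; rewrite /dist2 cyc.
    (* The reflected vector has first coordinate |y|^2 / r^2, which this factor normalizes to 1. *)
    exists (r ^+ 2 / dot y y); first by rewrite divr_gt0 ?exprn_gt0 // lt_neqAle dot_ge0 eq_sym y0.
    rewrite /refl dd /lform /lscale /= !dotE (dotC y c).
    apply: lorentz_eq => /=; try by (field; rewrite rn0 y0).
    rewrite !scalerDr scalerA addrAC -scalerDl -[X in X + _ = _]scale1r.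
    by congr (_ *: _ + _); field; rewrite rn0 y0.
  move=> x Dx; exists (- 1); first by rewrite oppr_eq0 oner_eq0.
  rewrite /= scale1r scaleN1r opprB; exact: normal_round.
have nn : dot n n != 0 by rewrite dot_eq0.
pose d : lorentz R := (0, 2 * e, n).
have dd : lform d d = dot n n by rewrite /lform /=; field.
exists d; rewrite dd; split.
- by rewrite lt_neqAle dot_ge0 eq_sym nn.
- apply/seteqP; split=> -[x|] //=; rewrite /lform /= ?dot0r; lra.
- case=> [x|] //=; congr Some; rewrite !dotE -addrA -opprD -scalerDl.
  rewrite -[RHS]subr0 -(scale0r n); congr (_ - _ *: _); by field.
- case=> [x|] /=; exists 1 => //; rewrite /refl dd /lform /lscale /=.
    rewrite !dotE (dotC x n); apply: lorentz_eq => /=; try by field.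
    by rewrite -scaleNr scale1r; congr (_ + _ *: _); field.
  rewrite dot0l; apply: lorentz_eq => /=; try by field.
  by rewrite [X in _ + X *: _](_ : _ = 0) ?scale0r ?addr0 ?scaler0 //; field.
- move=> x Dx; exists 1; first exact: oner_neq0.
  rewrite /= scale0r subr0 scale1r; exact: normal_plane.
Qed.
End Lorentz.

(** * Oriented spheres as Lorentz vectors *)

Arguments light : simpl never.

Section Spheres.
Variable R : realType.
Implicit Types (v w d : lorentz R) (p : Defs.point R).

(** Completing the square, with |u|^2 = 1 + ab: the center is u/b and the squared radius 1/b^2. *)
Lemma dist2_center v x : lform v v = 1 -> v.1.1 != 0 ->
  dist2 x (v.1.1^-1 *: v.2) = v.1.1^-1 ^+ 2 - 2 / v.1.1 * lform v (light (Some x)).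
Proof.
case: v => [[b a] u]; rewrite /lform /light /dist2 /= !dotE (dotC x u) => vv b0.
have -> : dot u u = 1 + b * a by lra.
by field.
Qed.

Variant osph_spec v : osphere R -> R -> Prop :=
| OsphInner of 0 < v.1.1 :
    osph_spec v (oball (v.1.1^-1 *: v.2) v.1.1^-1) v.1.1
| OsphOuter of v.1.1 < 0 :
    osph_spec v (round (v.1.1^-1 *: v.2) (- v.1.1^-1), outer (v.1.1^-1 *: v.2) (- v.1.1^-1)) v.1.1
| OsphPlane of v.2 != 0 : osph_spec v (ohalfspace v.2 (v.1.2 / 2)) 0.

Lemma osphP v : lform v v = 1 -> osph_spec v (osph v) v.1.1.
Proof.
move=> vv; have D := dist2_center _ vv.
set b := v.1.1 in D *.
have noninf : b != 0 -> lform v (light None) != 0.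
  by rewrite /lform /light /= dot0r -/b => b0; apply/eqP => h; move/eqP: b0; lra.
have on x : b != 0 -> (dist2 x (b^-1 *: v.2) = b^-1 ^+ 2) <-> lform v (light (Some x)) = 0.
  move=> bN; rewrite D //; split=> [/eqP|->]; last by rewrite mulr0 subr0.
  rewrite -subr_eq0 addrAC subrr add0r oppr_eq0 mulf_eq0.
  by rewrite mulf_eq0 invr_eq0 (negPf bN) pnatr_eq0 /= => /eqP.
have [b0|b0|b0] := ltgtP b 0.
- have bN : b != 0 by rewrite lt_eqF.
  have kn : 0 < - (2 / b) by rewrite oppr_gt0 pmulr_rlt0 ?invr_lt0.
  have -> : osph v = (round (b^-1 *: v.2) (- b^-1), outer (b^-1 *: v.2) (- b^-1)).
    congr (_, _); apply/seteqP; split=> -[x|] //=; rewrite ?sqrrN.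
    + by case: (on x bN).
    + by move/eqP; rewrite (negPf (noninf bN)).
    + by case: (on x bN).
    + by rewrite D // ltrDl -mulNr pmulr_rgt0.
    + by rewrite D // ltrDl -mulNr pmulr_rgt0.
    + by move=> _; rewrite /lform /light /= dot0r -/b; lra.
  exact: OsphOuter.
- have bN : b != 0 by rewrite gt_eqF.
  have kn : 0 < 2 / b by rewrite divr_gt0.
  have -> : osph v = oball (b^-1 *: v.2) b^-1.
    congr (_, _); apply/seteqP; split=> -[x|] //=.
    + by case: (on x bN).
    + by move/eqP; rewrite (negPf (noninf bN)).
    + by case: (on x bN).
    + by rewrite D // ltrBlDr ltrDl pmulr_rgt0.
    + by rewrite /lform /light /= dot0r -/b; lra.
    + by rewrite D // ltrBlDr ltrDl pmulr_rgt0.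
  exact: OsphInner.
- have u0 : v.2 != 0.
    by rewrite -dot_eq0; move: vv; rewrite /lform -/b b0 => vv; apply/eqP; lra.
  have -> : osph v = ohalfspace v.2 (v.1.2 / 2).
    congr (_, _); apply/seteqP; split=> -[x|] //=; rewrite /lform /light /= -/b b0 ?dot0r; lra.
  by rewrite b0; exact: OsphPlane.
Qed.

Lemma osph_bend v : lform v v = 1 -> bend (osph v) = v.1.1.
Proof.
move=> vv; apply: bendP; case: (osphP vv) => [b0|b0|u0].
- rewrite -[X in has_bend _ X]invrK; apply: has_bend_inner.
  by rewrite invr_gt0.
- have {5}-> : v.1.1 = - (- v.1.1^-1)^-1 by rewrite invrN invrK opprK.
  by apply: has_bend_outer; rewrite oppr_gt0 invr_lt0.
- exact: has_bend_plane.
Qed.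

(** The vector u - bx is the gradient at x of the function defining the sphere, hence a normal for
    spheres and planes alike. *)
Lemma osph_normal v x : lform v v = 1 -> (osph v).1 (Some x) ->
  exists2 k, k != 0 & normal_at (osph v).1 x (k *: (v.2 - v.1.1 *: x)).
Proof.
move=> vv; set u := v.2 - _.
have uE : v.1.1 != 0 -> - v.1.1^-1 *: u = x - v.1.1^-1 *: v.2.
  by move=> b0; rewrite /u scalerBr scalerA !mulNr mulVf // !scaleNr scale1r opprK addrC.
have : v.1.1 = 0 -> u = v.2 by rewrite /u => ->; rewrite scale0r subr0.
move: uE; case: (osphP vv) => [b0|b0|u0] uE uE0 vx.
- exists (- v.1.1^-1); first by rewrite oppr_eq0 invr_eq0 gt_eqF.
  by rewrite uE ?gt_eqF //; apply: normal_round; rewrite ?invr_gt0.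
- exists (- v.1.1^-1); first by rewrite oppr_eq0 invr_eq0 lt_eqF.
  by rewrite uE ?lt_eqF //; apply: normal_round vx; rewrite oppr_gt0 invr_lt0.
- by exists 1; rewrite ?oner_eq0 // scale1r uE0 //; apply: normal_plane.
Qed.

(** This turns Euclidean orthogonality at a common point into Lorentz orthogonality. *)
Lemma lform_normal v d x : lform v (light (Some x)) = 0 -> lform d (light (Some x)) = 0 ->
  dot (v.2 - v.1.1 *: x) (d.2 - d.1.1 *: x) = lform v d.
Proof.
rewrite /lform /light /= !dotE (dotC x d.2) => vx dx.
have -> : dot v.2 x = (v.1.1 * dot x x + v.1.2) / 2 by lra.
have -> : dot d.2 x = (d.1.1 * dot x x + d.1.2) / 2 by lra.
by field.
Qed.

(* Only the linear shadow of an inversion is kept: the reflection in [d], which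
   fixes the vector of every sphere orthogonal to [D]. *)
Lemma inversion_act D f : inversion_in D f ->
  exists d, [/\ 0 < lform d d, involutive f,
    forall v, act f (osph v) = osph (refl d v) &
    forall v, lform v v = 1 -> Defs.orthogonal D (osph v).1 -> lform v d = 0].
Proof.
move=> /inversion_light[d [dd DE fK fl fn]]; exists d; split=> //.
  (* Reflections are self-adjoint, so testing [f p] against [v] is testing [p] against the reflected
     [v]. *)
  have fv v p : exists2 k, 0 < k & lform v (light (f p)) = k * lform (refl d v) (light p).
    by have [k k0 E] := fl p; exists k; rewrite // E lformZr refl_adj.
  move=> v; congr (_, _); apply/seteqP; split=> p /=.
  - case=> q vq <-{p}; have [k k0] := fv v (f q); rewrite fK vq => /esym/eqP.
    by rewrite mulf_eq0 gt_eqF //= => /eqP.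
  - move=> vp; exists (f p) => //; have [k k0 ->] := fv v p.
    by rewrite vp mulr0.
  - case=> q vq <-{p}; have [k k0] := fv v (f q); rewrite fK => E.
    by move: vq; rewrite /= E pmulr_rgt0.
  - move=> vp; exists (f p) => //=; have [k k0 ->] := fv v p.
    by rewrite pmulr_rgt0.
move=> v vv [[x [Dx vx]] orth].
have [k k0 Dn] := fn _ Dx; have [h h0 vn] := osph_normal vv vx.
have := orth _ _ _ Dn vn; rewrite dotZl dotZr.
move/eqP; rewrite !mulf_eq0 (negPf k0) (negPf h0) /= dotC => /eqP.
by rewrite lform_normal //; move: Dx; rewrite DE.
Qed.

(** [M] composes reflections and its adjoint [N] composes them in reverse order; [N] moves the
    action from the spheres to one fixed vector. *)
Lemma moebius_act f : moebius f ->
  exists M N : lorentz R -> lorentz R,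
   [/\ bijective f, forall v, act f (osph v) = osph (M v),
    forall v, lform (M v) (M v) = lform v v,
    forall v, lform (N v) (N v) = lform v v &
    forall v w, lform v (M w) = lform (N v) w].
Proof.
elim=> [|D {}f g /inversion_act[d [dd fK fa _]] _ [M [N [gB ga Mi Ni MN]]]].
  exists id, id; split=> // [|v]; first by exists id.
  by rewrite /act !image_id; case: (osph v).
have d0 : lform d d != 0 by rewrite gt_eqF.
exists (refl d \o M), (N \o refl d); split=> [|v|v|v|v w] /=.
- by apply: bij_comp gB; exists f.
- by rewrite -fa -ga /act /= !image_comp.
- by rewrite refl_form.
- by rewrite Ni refl_form.
- by rewrite refl_adj MN.
Qed.

(** A nonzero null vector represents the point u/b, or infinity when b = 0. Orthogonality to a
    finite x forces |x - u/b|^2 = 0 if b is nonzero, and is impossible if b = 0. *)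
Lemma null_lform_zero w : lform w w = 0 -> w != 0 ->
  exists p k, [/\ k != 0, w = lscale k (light p) &
    forall q, lform w (light q) = 0 -> q = p].
Proof.
case: w => [[b a] u] ww w0; have uu : dot u u = b * a.
  by move: ww; rewrite /lform /=; lra.
have [b0|bN] := eqVneq b 0.
  have u0 : u = 0 by apply/eqP; rewrite -dot_eq0 uu b0 mul0r.
  have aN : a != 0 by apply: contraNneq w0 => a0; rewrite b0 a0 u0.
  exists None, a; split=> //.
    by rewrite /lscale /= mulr0 mulr1 scaler0 b0 u0.
  case=> [x|//]; rewrite /lform /light /= b0 u0 dot0l => /eqP.
  by rewrite mul0r mulr1 sub0r add0r oppr_eq0 mulf_eq0 (negPf aN) invr_eq0 pnatr_eq0.
exists (Some (b^-1 *: u)), b; split=> //.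
  apply: lorentz_eq; rewrite /= ?mulr1 ?scalerA ?divff ?scale1r //.
  by rewrite dotZl dotZr uu; field.
case=> [x|]; rewrite /lform /light /= => h; last first.
  by case/eqP: bN; rewrite dot0r in h; lra.
congr Some; apply/eqP; rewrite -subr_eq0 -dot_eq0 !dotE (dotC x u) uu.
by apply/eqP; transitivity (dot x x - 2 / b * dot u x + a / b);
  [|have -> : dot u x = (b * dot x x + a) / 2 by lra]; field.
Qed.

(** Orthogonality to a finite x would give |bx - u|^2 = |u|^2 - ab < 0. *)
Lemma timelike_lform_neq0 w p : lform w w < 0 -> lform w (light p) != 0.
Proof.
case: w => [[b a] u]; rewrite {1}/lform /= => ww.
have uu : dot u u < b * a by lra.
apply/eqP; case: p => [x|]; rewrite /lform /light /= => h; last first.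
  have b0 : b = 0 by rewrite dot0r in h; lra.
  by have := dot_ge0 u; rewrite leNgt; move: uu; rewrite b0 mul0r => ->.
have := dot_ge0 (b *: x - u); rewrite !dotE (dotC x u).
have -> : dot u x = (b * dot x x + a) / 2 by lra.
by rewrite leNgt; apply/negP; rewrite negbK; lra.
Qed.

(** The sum [v + w] is null, and the point it represents is the contact point. *)
Lemma osph_tangent v w : lform v v = 1 -> lform w w = 1 -> lform v w = -1 ->
  v + w != 0 -> tangent (osph v) (osph w).
Proof.
move=> vv ww vw /null_lform_zero[].
  by rewrite lformDl !lformDr (lformC w v) vv ww vw; ring.
move=> p [k [k0 E pU]]; exists p.
have lp u : lform u (light p) = lform u (v + w) / k.
  by rewrite E lformZr; field.
apply/seteqP; split=> q /=.
  by case=> vq wq; apply: pU; rewrite lformDl vq wq addr0.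
by move=> ->; rewrite !lp !lformDr (lformC w v) vv ww vw subrr addNr mul0r.
Qed.

Lemma osph_disjoint v w : lform v v = 1 -> lform w w = 1 -> lform v w < -1 ->
  disjoint_spheres (osph v) (osph w).
Proof.
move=> vv ww vw; apply/seteqP; split=> // p [/= vp wp].
have : lform (v + w) (v + w) < 0.
  by rewrite lformDl !lformDr (lformC w v) vv ww; lra.
by move/(timelike_lform_neq0 p); rewrite lformDl vp wp addr0 eqxx.
Qed.

End Spheres.

(** * Orderings of the configuration and bends modulo 4 *)

Section Combinatorics.

Definition tangency_pattern (R : realType) (s : 'I_8 -> osphere R) : Prop :=
  forall i j : 'I_8, i != j ->
    if i == j %[mod 4] then disjoint_spheres (s i) (s j) else tangent (s i) (s j).

Variables (R : realType) (s : 'I_8 -> osphere R).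
Hypothesis hs : tangency_pattern s.

Lemma antipodal_pair_off (i : 'I_8) : exists k l : 'I_8,
  [/\ tangent (s i) (s k), tangent (s i) (s l) & disjoint_spheres (s k) (s l)].
Proof.
(* The antipodal pair is 0, 4, or 1, 5 when [i] belongs to the former. *)
pose k : 'I_8 := if (i %% 4 == 0)%N then inord 1 else inord 0.
pose l : 'I_8 := inord (k + 4).
have kE : (k : nat) = if (i %% 4 == 0)%N then 1%N else 0%N.
  by rewrite /k; case: ifP; rewrite inordK.
have lE : (l : nat) = (k + 4)%N by rewrite inordK // kE; case: ifP.
have ik : (i == k %[mod 4])%N = false by rewrite kE; case: ifP; lia.
have il : (i == l %[mod 4])%N = false by rewrite lE modnDr.
have kl : (k == l %[mod 4])%N by rewrite lE modnDr.
have neq (a b : 'I_8) : (a == b %[mod 4])%N = false -> a != b.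
  by move=> h; apply: contraFneq h => ->; rewrite eqxx.
exists k, l; split.
- by have := hs (neq _ _ ik); rewrite ik.
- by have := hs (neq _ _ il); rewrite il.
- have : k != l by apply/eqP => /(congr1 val) /=; rewrite lE; lia.
  by move/hs; rewrite kl.
Qed.

(** The case i = j matters: a sphere tangent to itself would be a single point, lying on both
    members of a disjoint pair. *)
Lemma tangent_nantipodal (i j : 'I_8) :
  tangent (s i) (s j) -> (i == j %[mod 4])%N = false.
Proof.
move=> [p E]; apply/negP => ij; have [eij|nij] := eqVneq i j; last first.
  have := hs nij; rewrite ij /disjoint_spheres E => /seteqP[/(_ p)].
  by move=> /(_ erefl).
move: E; rewrite -eij setIid => E.
have [k [l [[p1 E1] [p2 E2] kl]]] := antipodal_pair_off i.
move: E1 E2; rewrite !E => /seteqP[_ /(_ p1 erefl) [/= -> kp]].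
move=> /seteqP[_ /(_ p2 erefl) [/= -> lp]].
by move/seteqP: kl => [/(_ p) /= h _]; apply: h.
Qed.

Lemma tangency_pattern_inj : injective s.
Proof.
move=> i j sij; apply/eqP; apply: contraT => nij.
have [k [_ [[p /seteqP[_ /(_ p erefl) [ip _]]] _ _]]] := antipodal_pair_off i.
have := hs nij; case: ifP => [_|/negP + t].
  by rewrite -sij /disjoint_spheres setIid => /seteqP[/(_ p ip)].
by move: t; rewrite -sij => /tangent_nantipodal; rewrite eqxx.
Qed.

End Combinatorics.

(** Signed permutations of four axes, that is, the orthoplicial group acting on indices, in boolean
    form so that membership can be computed. *)
Definition signed_perm (l : seq nat) : bool :=
  all (fun j => (nth 0%N l j < 8)%N && all (fun k =>
    ((nth 0 l j == nth 0 l k) == (j == k))%N &&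
    ((nth 0 l j == nth 0 l k %[mod 4]) == (j == k %[mod 4]))%N)
    (iota 0 8)) (iota 0 8).

Lemma signed_permP (l : seq nat) : signed_perm l ->
  [/\ forall k, (k < 8)%N -> (nth 0 l k < 8)%N &
      forall j k, (j < 8)%N -> (k < 8)%N ->
        ((nth 0 l j == nth 0 l k) = (j == k)) *
        ((nth 0 l j == nth 0 l k %[mod 4]) = (j == k %[mod 4]))]%N.
Proof.
move=> /allP h; have i8 k : (k < 8)%N -> k \in iota 0 8 by rewrite mem_iota.
split=> [k /i8/h/andP[]//|j k /i8/h/andP[_ /allP h'] /i8/h'/andP[/eqP -> /eqP ->]].
by [].
Qed.

Lemma signed_perm_bij (l : seq nat) : signed_perm l ->
  exists2 p : 'I_8 -> 'I_8, bijective p & forall k, p k = nth 0%N l k :> nat.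
Proof.
move=> /signed_permP[l8 lE]; pose p (k : 'I_8) := Ordinal (l8 k (ltn_ord k)).
exists p => //; apply: injF_bij => i j [/eqP].
by rewrite (lE i j (ltn_ord i) (ltn_ord j)).1 => /eqP/val_inj.
Qed.

(** Indices i and 4 + i are antipodal. The ring is arbitrary so that the relations pass from real to
    integer bends. *)
Definition orthoplicial (A : pzRingType) (c : nat -> A) : Prop :=
  (forall i, (i < 4)%N -> c i + c (4 + i)%N = c 0%N + c 4%N) /\
  2 * (c 0%N * c 4%N + c 1%N * c 5%N + c 2%N * c 6%N + c 3%N * c 7%N) = (c 0%N + c 4%N) ^+ 2.

(** The antipodal sum is even because its square is twice an integer. *)
Lemma orthoplicial_half (c : nat -> int) : orthoplicial c ->
  exists m : int, [/\ forall i, (i < 4)%N -> c (4 + i)%N = 2 * m - c i &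
    c 0%N * (2 * m - c 0%N) + c 1%N * (2 * m - c 1%N) + c 2%N * (2 * m - c 2%N) +
    c 3%N * (2 * m - c 3%N) = 2 * m ^+ 2].
Proof.
move=> [h1 h2]; have [m E] : exists m, c 0%N + c 4%N = 2 * m.
  exists ((c 0%N + c 4%N) %/ 2)%Z.
  have : (c 0%N + c 4%N = 2 * ((c 0%N + c 4%N) %/ 2)%Z + ((c 0%N + c 4%N) %% 2)%Z) by lia.
  set s := c 0%N + c 4%N in h2 *; set m := (s %/ 2)%Z; set r := (s %% 2)%Z => E.
  have : r = 0 \/ r = 1 by lia.
  case=> rE; first lia.
  move: h2; rewrite E rE; lia.
have h i : (i < 4)%N -> c (4 + i)%N = 2 * m - c i by move/h1; lia.
exists m; split=> //.
move: h2; have /= -> := h 0%N isT; have /= -> := h 1%N isT.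
have /= -> := h 2%N isT; have /= -> := h 3%N isT; nia.
Qed.

(* The relation is quadratic in the half-sum [m]; fixing one bend of each
   antipodal pair, its two roots add up to the (even) sum of the fixed bends. *)
Lemma orthoplicial_mod4 (c c' : nat -> int) : orthoplicial c -> orthoplicial c' ->
  (forall i, (i < 4)%N -> c' i = c i \/ c' (4 + i)%N = c (4 + i)%N) ->
  forall i, (i < 8)%N -> (c' i = c i %[mod 4])%Z.
Proof.
move=> /orthoplicial_half[m [h hq]] /orthoplicial_half[m' [h' hq']] E.
(* The bend shared by [c] and [c'] in the i-th pair. *)
pose x i := if c' i == c i then c i else c (4 + i)%N.
have xE i : (i < 4)%N ->
    c i * (2 * m - c i) = x i * (2 * m - x i) /\ c' i * (2 * m' - c' i) = x i * (2 * m' - x i).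
  move=> i4; rewrite /x; case: eqVneq => [->//|ne].
  case: (E i i4) => [e|]; first by rewrite e eqxx in ne.
  rewrite (h i i4) (h' i i4) => e; split; first ring.
  have -> : c' i = 2 * m' - (2 * m - c i) by lia.
  ring.
have mm : (2 * m = 2 * m' %[mod 4])%Z.
  move: hq hq'.
  have [-> ->] := xE 0%N isT; have [-> ->] := xE 1%N isT.
  have [-> ->] := xE 2%N isT; have [-> ->] := xE 3%N isT.
  move: (x 0%N) (x 1%N) (x 2%N) (x 3%N) => x0 x1 x2 x3 hq hq'.
  have even (y : int) : exists z : int, y * y = y + 2 * z.
    exists ((y * (y - 1)) %/ 2)%Z.
    have [z [->|->]] : exists z : int, y = 2 * z \/ y = 2 * z + 1.
      by exists (y %/ 2)%Z; lia.
    - rewrite (_ : 2 * z * (2 * z - 1) = z * (2 * z - 1) * 2); last ring.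
      by rewrite mulzK //; ring.
    - rewrite (_ : (2 * z + 1) * (2 * z + 1 - 1) = z * (2 * z + 1) * 2); last ring.
      by rewrite mulzK //; ring.
  (* Half the difference of the two quadratic relations. *)
  have : (m - m') * (m + m' - (x0 + x1 + x2 + x3)) = 0 by nia.
  move/eqP; rewrite mulf_eq0 => /orP[|] /eqP mE; first by rewrite (_ : m = m') //; lia.
  have [z0 e0] := even x0; have [z1 e1] := even x1.
  have [z2 e2] := even x2; have [z3 e3] := even x3.
  (* The sum of the shared bends has the parity of the sum of their squares, which [hq] makes
     even. *)
  have : m + m' = 2 * (m * (x0 + x1 + x2 + x3) - m ^+ 2 - z0 - z1 - z2 - z3) by nia.
  move: (_ - z3) => z; lia.
have H i : (i < 4)%N -> (c' i = c i %[mod 4] /\ c' (4 + i)%N = c (4 + i)%N %[mod 4])%Z.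
  move=> i4; have := h i i4; have := h' i i4; case: (E i i4) => ->; lia.
move=> i i8; have [i4|i4] := ltnP i 4; first by have [] := H i i4.
have := H (i - 4)%N; rewrite subnKC // => -[]; lia.
Qed.

(* [7] and [3] are -1 modulo 8 and modulo 4, so that residues stay in [nat]. *)
Definition rel_mod8 (r : seq nat) (m : nat) : bool :=
  (sumn [seq x * (2 * m + 7 * x) | x <- r] == 2 * m ^ 2 %[mod 8])%N.

Definition residues (r : seq nat) (m : nat) : seq nat :=
  r ++ [seq ((2 * m + 3 * x) %% 4)%N | x <- r].

Definition target (e : nat) : seq nat := [:: 0; 0; e; e; 2; 2; e; e]%N.

(* Even pairs first, each starting with its bend divisible by 4. *)
Definition bend_order (r : seq nat) : seq nat :=
  let q := [seq (i + 4 * (nth 0 r i == 2))%N | i <- iota 0 4 & ~~ odd (nth 0%N r i)] ++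
    [seq i <- iota 0 4 | odd (nth 0%N r i)] in
  q ++ [seq ((i + 4) %% 8)%N | i <- q].

(** An exhaustive check of the 4^5 cases, with [bend_order] supplying the permutation whenever some
    residue is odd. *)
Lemma residues_classification (r0 r1 r2 r3 m : nat) :
  (r0 < 4 -> r1 < 4 -> r2 < 4 -> r3 < 4 -> m < 4 ->
   let r := [:: r0; r1; r2; r3] in rel_mod8 r m ->
   all (fun x => ~~ odd x) (residues r m) \/
   exists l e, [/\ signed_perm l, e \in [:: 1; 3] &
     [seq nth 0 (residues r m) k | k <- l] = target e])%N.
Proof.
have i4 k : (k < 4)%N -> k \in iota 0 4 by rewrite mem_iota.
have : all (fun r0 => all (fun r1 => all (fun r2 => all (fun r3 => all (fun m =>
    let r := [:: r0; r1; r2; r3] in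
    if rel_mod8 r m then
      if all (fun x => ~~ odd x) (residues r m) then true else
      let l := bend_order r in
      let bs := [seq nth 0%N (residues r m) k | k <- l] in
      signed_perm l && ((bs == target 1) || (bs == target 3))
    else true)
  (iota 0 4)) (iota 0 4)) (iota 0 4)) (iota 0 4)) (iota 0 4) by vm_compute.
move=> /allP h /i4/h{h} /allP h /i4/h{h} /allP h /i4/h{h} /allP h /i4/h{h} /allP h.
move=> /i4/h{h} h r rel; move: h; cbv zeta; rewrite -/r rel.
case: ifP => [|_ /andP[lP /orP[]/eqP E]]; first by left.
  by right; exists (bend_order r), 1%N.
by right; exists (bend_order r), 3%N.
Qed.

Lemma orthoplicial_classification (c : nat -> int) : orthoplicial c ->
  (forall k, (k < 8)%N -> (2 %| c k)%Z) \/
  exists l eps, [/\ signed_perm l, eps = 1 \/ eps = -1 &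
    forall k, (k < 8)%N ->
      (c (nth 0%N l k) = [:: 0; 0; eps; eps; 2; 2; eps; eps]`_k %[mod 4])%Z].
Proof.
move=> /orthoplicial_half[m [h hq]].
pose r (x : int) := `|(x %% 4)%Z|%N.
have r4 x : (r x < 4)%N by rewrite /r; lia.
have rE x : x = 4 * (x %/ 4)%Z + (r x)%:Z by rewrite /r; lia.
pose rs := [:: r (c 0%N); r (c 1%N); r (c 2%N); r (c 3%N)].
have rel : rel_mod8 rs (r m).
  (* Changing x and m by multiples of 4 changes x(2m - x) by a multiple of 8, so residues modulo 4
     suffice. *)
  have sq (x : int) : exists z : int,
      x * (2 * m - x) = (r x)%:Z * (2 * (r m)%:Z + 7 * (r x)%:Z) + 8 * z.
    have := rE x; have := rE m; move: (x %/ 4)%Z (m %/ 4)%Z.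
    move: (r x)%:Z (r m)%:Z => s u q p -> ->.
    exists (p * s + 4 * q * p + q * u - 2 * q ^+ 2 - q * s - s ^+ 2); ring.
  have [z0 e0] := sq (c 0%N); have [z1 e1] := sq (c 1%N).
  have [z2 e2] := sq (c 2%N); have [z3 e3] := sq (c 3%N).
  have em : exists z, 2 * m ^+ 2 = 2 * (r m)%:Z ^+ 2 + 8 * z.
    have := rE m; move: (m %/ 4)%Z (r m)%:Z => p u ->.
    exists (2 * p * u + 4 * p ^+ 2); ring.
  move: em => [z em]; move: hq; rewrite e0 e1 e2 e3 em /rel_mod8 /rs /=.
  move: (r m) (r (c 0%N)) (r (c 1%N)) (r (c 2%N)) (r (c 3%N)) => u s0 s1 s2 s3.
  lia.
have res k : (k < 8)%N -> (c k = (nth 0%N (residues rs (r m)) k)%:Z %[mod 4])%Z.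
  case: k => [|[|[|[|[|[|[|[|//]]]]]]]] _ /=; try (rewrite /r; lia).
  - rewrite (h 0%N isT) /r; lia.
  - rewrite (h 1%N isT) /r; lia.
  - rewrite (h 2%N isT) /r; lia.
  - rewrite (h 3%N isT) /r; lia.
case: (residues_classification (r4 _) (r4 _) (r4 _) (r4 _) (r4 _) rel).
  move=> /allP ev; left=> k k8; have := res k k8.
  have /ev : nth 0%N (residues rs (r m)) k \in residues rs (r m) by rewrite mem_nth.
  lia.
move=> [l [e [lP eP tE]]]; right; have [l8 _] := signed_permP lP.
exists l, (if e == 1%N then 1 else -1); split=> //.
  by case: ifP; [left|right].
move=> k k8; rewrite (res _ (l8 k k8)).
have sl : size l = 8 by rewrite -(size_map (nth 0%N (residues rs (r m)))) tE.
rewrite -(nth_map 0%N 0%N) ?sl // tE.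
by move: eP; rewrite !inE => /orP[] /eqP ->; move: k8; case: k => [|[|[|[|[|[|[|[|//]]]]]]]].
Qed.

(** * The standard configuration in Lorentz coordinates *)

Section Standard.
Variable R : realType.

Lemma osph_oball (c : 'rV[R]_3) r : 0 < r ->
  osph (r^-1, dot c c / r - r, r^-1 *: c) = oball c r.
Proof.
move=> r0; have rN : r != 0 by rewrite gt_eqF.
set v := (_, _, _); have vv : lform v v = 1.
  by rewrite /lform /= dotZl dotZr; field.
have b0 : 0 < v.1.1 by rewrite /= invr_gt0.
have bc : v.1.1^-1 *: v.2 = c by rewrite /= scalerA invrK divff // scale1r.
have br : v.1.1^-1 = r by rewrite /= invrK.
clearbody v; case: (osphP vv) b0 bc br => [_ _ -> -> //|/lt_trans h /h|_].
  by rewrite ltxx.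
by rewrite ltxx.
Qed.

Lemma osph_ohalfspace (n : 'rV[R]_3) e : osph (0, 2 * e, n) = ohalfspace n e.
Proof.
congr (_, _); apply/seteqP; split=> -[x|] //=; rewrite /lform /light /= ?dot0r; lra.
Qed.

(** Every antipodal pair k, k + 4 adds up to (2, 2, 0). *)
Definition stdvec (k : nat) : lorentz R :=
  nth 0 [:: (0, 2, vec3 0 0 1); (0, 2, vec3 0 0 (-1));
    (1, 1, vec3 (Num.sqrt 2) 0 0); (1, 1, vec3 0 (Num.sqrt 2) 0);
    (2, 0, vec3 0 0 (-1)); (2, 0, vec3 0 0 1);
    (1, 1, vec3 (- Num.sqrt 2) 0 0); (1, 1, vec3 0 (- Num.sqrt 2) 0)] k.

Lemma dot_vec3 (v : 'rV[R]_3) (x y z : R) :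
  dot v (vec3 x y z) = v 0 0 * x + v 0 1 * y + v 0 2 * z.
Proof.
rewrite /dot !big_ord_recl big_ord0 !mxE !(tnth_nth 0) /= addr0 addrA.
by congr (_ * _ + _ * _ + _ * _); congr (v 0 _); apply: val_inj.
Qed.

Lemma vec3E (x y z : R) :
  ((vec3 x y z 0 0 = x) * (vec3 x y z 0 1 = y) * (vec3 x y z 0 2 = z))%type.
Proof. by rewrite !mxE !(tnth_nth 0). Qed.

Lemma sqrt22 : Num.sqrt 2 * Num.sqrt 2 = 2 :> R.
Proof. by rewrite -expr2 sqr_sqrtr. Qed.

Lemma scale_vec3 k (x y z : R) : k *: vec3 x y z = vec3 (k * x) (k * y) (k * z).
Proof.
by apply/rowP => -[[|[|[|//]]] ?]; rewrite !mxE !(tnth_nth 0).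
Qed.

Lemma lform_stdvec (i j : 'I_8) : lform (stdvec i) (stdvec j) =
  if i == j then 1 else if (i == j %[mod 4])%N then - 3 else - 1.
Proof.
have h := sqrt22.
case: i j => [[|[|[|[|[|[|[|[|//]]]]]]]] ?] [[|[|[|[|[|[|[|[|//]]]]]]]] ?];
  rewrite /lform /stdvec /= dot_vec3 !vec3E ?(mulNr, mulrN) ?h; lra.
Qed.

Lemma standardE (k : 'I_8) : standard R k = osph (stdvec k).
Proof.
case: k => [[|[|[|[|[|[|[|[|//]]]]]]]] ?]; rewrite /standard (tnth_nth (oball 0 0)) /stdvec /=;
  (rewrite -osph_ohalfspace mulr1 //) || (rewrite -osph_oball ?divr_gt0 ?ltr01 ?ltr0n //;
   rewrite dot_vec3 !vec3E scale_vec3; congr (osph (_, _, vec3 _ _ _)));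
   rewrite ?(mulNr, mulrN) ?sqrt22; lra.
Qed.

Lemma standard_tangency : tangency_pattern (@standard R).
Proof.
have vv (i : 'I_8) : lform (stdvec i) (stdvec i) = 1 by rewrite lform_stdvec eqxx.
move=> i j ij; rewrite !standardE; have := lform_stdvec i j; rewrite (negPf ij).
case: ifP => _ vij.
  by apply: osph_disjoint; rewrite // vij ltrN2 ltr1n.
apply: osph_tangent => //; apply/eqP => v0.
(* Pairing with the common antipodal sum shows that the two vectors are not opposite. *)
have : lform (stdvec i + stdvec j) (2, 2, 0) = - 4.
  have h (k : 'I_8) : lform (stdvec k) (2, 2, 0) = - 2.
    case: k => [[|[|[|[|[|[|[|[|//]]]]]]]] ?]; rewrite /lform /stdvec /= dot0r; lra.
  by rewrite lformDl !h; lra.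
by rewrite v0 /lform /= dot0r; lra.
Qed.

(** Each antipodal pair is t + w_k, t - w_k with t = (1, 1, 0) of norm -1 and the w_k of norm 2, all
    orthogonal. Nullity of [n] says that the squares of the <n, w_k> add up to 2<n, t>^2, which is
    the quadratic relation. *)
Lemma orthoplicial_lform (n : lorentz R) : lform n n = 0 ->
  orthoplicial (fun k => lform n (stdvec k)).
Proof.
case: n => [[p q] u]; rewrite {1}/lform /= => nn.
have h := sqrt22.
have uu : dot u u = u 0 0 ^+ 2 + u 0 1 ^+ 2 + u 0 2 ^+ 2.
  rewrite /dot !big_ord_recl big_ord0 addr0 !expr2 addrA.
  by congr (_ * _ + _ * _ + _ * _); congr (u 0 _); apply: val_inj.
rewrite uu in nn; split.
  case=> [|[|[|[|//]]]] _; rewrite /lform /stdvec /= !dot_vec3; lra.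
rewrite /lform /stdvec /= !dot_vec3.
set t := Num.sqrt 2 in h *; move: (u 0 0) (u 0 1) (u 0 2) nn => x y z nn; nra.
Qed.
End Standard.

(** * Packings *)

Section Packing.
Variable R : realType.
Implicit Types (f g : Defs.point R -> Defs.point R) (W V : set (osphere R)) (c : nat -> int).

Lemma act_comp f g X : act (f \o g) X = act f (act g X).
Proof. by rewrite /act /= !image_comp. Qed.

Lemma image_setI_inj f (A B : set (Defs.point R)) : injective f ->
  (f @` A) `&` (f @` B) = f @` (A `&` B).
Proof.
move=> fI; apply/seteqP; split=> p.
  by case=> -[x Ax <-] [y By /fI xy]; exists x => //; split=> //; rewrite -xy.
by case=> x [Ax Bx] <-; split; exists x.
Qed.

Lemma tangency_pattern_act f (s : 'I_8 -> osphere R) : injective f ->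
  tangency_pattern s -> tangency_pattern (fun k => act f (s k)).
Proof.
move=> fI hs i j /hs; rewrite /disjoint_spheres /tangent /= image_setI_inj //.
case: ifP => _.
  by move=> ->; rewrite image_set0.
by case=> p ->; exists (f p); rewrite image_set1.
Qed.

(** Keeping the map [f] labels the spheres of [W], so bends of successive configurations can be
    compared index by index. *)
Definition configuration f c W : Prop :=
  [/\ moebius f, W = act f @` range (@standard R),
      forall k : 'I_8, bend (act f (standard R k)) = (c k)%:~R & orthoplicial c].

Lemma orthoplicial_bends f : moebius f -> exists2 cR : nat -> R, orthoplicial cR &
  forall k : 'I_8, bend (act f (standard R k)) = cR k.
Proof.
move=> /moebius_act[M [N [_ fa Mi Ni MN]]].
(* A multiple of the null vector of infinity, scaled so that its product with any vector is the
   bend. *)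
pose e : lorentz R := (0, - 2, 0).
exists (fun k => lform (N e) (stdvec R k)).
  by apply: orthoplicial_lform; rewrite Ni /lform /e /= dot0r; lra.
move=> k; rewrite standardE fa osph_bend; last by rewrite Mi lform_stdvec eqxx.
by rewrite -MN /lform /e /= dot0l; lra.
Qed.

Lemma configuration_exists f : moebius f ->
  (forall k : 'I_8, exists z : int, bend (act f (standard R k)) = z%:~R) ->
  exists c, configuration f c (act f @` range (@standard R)).
Proof.
move=> fM /choice[z zE]; have [cR [h1 h2] cE] := orthoplicial_bends fM.
exists (fun n => z (inord n)); split=> // [k|]; first by rewrite inord_val zE.
have zc n : (n < 8)%N -> (z (inord n))%:~R = cR n by move=> n8; rewrite -zE cE inordK.
split=> [i i4|]; apply/eqP; rewrite -(eqr_int R); apply/eqP.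
  by rewrite !rmorphD /= !zc ?h1 //; lia.
by rewrite rmorphM rmorphXn /= !rmorphD !rmorphM /= !zc // h2.
Qed.

(** Four pairwise tangent spheres have incongruent indices modulo 4, so they represent every
    antipodal pair once; orthogonality to the dual sphere fixes them. *)
Lemma dual_inversion_fixes f c W g : configuration f c W -> dual_inversion W g ->
  moebius (g \o f) /\
  forall i, (i < 4)%N -> exists k : 'I_8, (k = i :> nat \/ k = (4 + i)%N :> nat) /\
    act g (act f (standard R k)) = act f (standard R k).
Proof.
move=> [fM WE _ _] [q [D [[Wq qt] Dg orth]]]; split.
  exact: moebius_comp Dg fM.
have [M [N [fB fa Mi _ _]]] := moebius_act fM.
have hs : tangency_pattern (fun k => act f (standard R k)).
  by apply: tangency_pattern_act (@standard_tangency R); exact: bij_inj.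
have /choice[t tE] : forall i, exists k, q i = act f (standard R k).
  by move=> i; have := Wq i; rewrite WE => -[_ [k _ <-] <-]; exists k.
have t4 (i : 'I_4) : (t i %% 4 < 4)%N by rewrite ltn_mod.
have tI : injective (fun i => Ordinal (t4 i)).
  move=> i j [/eqP tij]; apply/eqP; apply: contraT => /qt.
  by rewrite !tE => /(tangent_nantipodal hs); rewrite tij.
have [u _ tu] := injF_bij tI.
move=> i i4; exists (t (u (Ordinal i4))); split.
  have := congr1 val (tu (Ordinal i4)); rewrite /=.
  by have := ltn_ord (t (u (Ordinal i4))); lia.
rewrite -tE; have [d [_ _ ga dorth]] := inversion_act Dg.
have := orth (u (Ordinal i4)); rewrite tE standardE fa => /dorth h.
by rewrite ga refl_fix // h // Mi lform_stdvec eqxx.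
Qed.

(** An inversion [g] replaces [f] by [g \o f], preserving labels; integrality of the packing keeps
    the bends in [int], and [orthoplicial_mod4] applies to each step. *)
Lemma family_configuration f0 c0 V W : configuration f0 c0 V ->
  (forall b, bends (packing V) b -> exists z : int, b = z%:~R) -> Defs.family V W ->
  exists f c, configuration f c W /\ forall k, (k < 8)%N -> (c k = c0 k %[mod 4])%Z.
Proof.
move=> V0 bint; elim=> [|{}W g VW [f [c [fc cc0]]] Wg]; first by exists f0, c0.
have [gfM gfix] := dual_inversion_fixes fc Wg.
have WE : act g @` W = act (g \o f) @` range (@standard R).
  have [_ -> _ _] := fc; rewrite image_comp.
  by congr (_ @` _); apply/funext => X; rewrite /= act_comp.
have [k|c' fc'] := configuration_exists gfM.
  apply: bint; exists (act (g \o f) (standard R k)) => //.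
  exists (act g @` W); first exact: family_invert.
  by rewrite WE; exists (standard R k) => //; exists k.
rewrite -WE in fc'; exists (g \o f), c'; split=> // k k8.
rewrite -cc0 //; have [_ _ cE co] := fc; have [_ _ cE' co'] := fc'.
apply: orthoplicial_mod4 co co' _ k k8 => i i4.
have [k [kE gk]] := gfix i i4.
have E : c' k = c k.
  by apply/eqP; rewrite -(eqr_int R) -cE -cE' act_comp gk.
by case: kE => <-; [left|right].
Qed.

Lemma configuration_ordering f c W (l : seq nat) : configuration f c W ->
  signed_perm l ->
  exists s : 'I_8 -> osphere R, admissible_ordering W s /\
    forall k : 'I_8, bend (s k) = (c (nth 0%N l k))%:~R.
Proof.
move=> [fM WE cE _] lP; have [_ lE] := signed_permP lP.
have [p pB pE] := signed_perm_bij lP; have [p' _ pp'] := pB.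
have [M [_ [fB _ _ _ _]]] := moebius_act fM.
have hs := tangency_pattern_act (bij_inj fB) (@standard_tangency R).
have hp : tangency_pattern (fun k => act f (standard R (p k))).
  move=> i j ij; have /hs : p i != p j by rewrite (inj_eq (bij_inj pB)).
  by rewrite /= !pE (lE i j (ltn_ord i) (ltn_ord j)).2.
exists (fun k => act f (standard R (p k))); split=> [|k]; last by rewrite cE pE.
split=> //; first exact: tangency_pattern_inj hp.
rewrite WE; apply/seteqP; split=> X.
  by case=> k _ <-; exists (standard R (p k)) => //; exists (p k).
by case=> _ [k _ <-] <-; exists (p' k); rewrite ?pp'.
Qed.

Definition bend_pattern (eps : int) (k : nat) : int := [:: 0; 0; eps; eps; 2; 2; eps; eps]`_k.

(** The sign is obtained from the generator [V]. Recording that its residue is attained lets signs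
    from different generators be compared. *)
Lemma primitive_packing_pattern V : platonic V -> primitive (packing V) ->
  exists eps : int, [/\ eps = 1 \/ eps = -1,
    forall b : int, bends (packing V) b%:~R -> (b <> - eps %[mod 4])%Z,
    exists2 b : int, bends (packing V) b%:~R & (b = eps %[mod 4])%Z &
    forall W, Defs.family V W -> exists (s : 'I_8 -> osphere R) (b : 'I_8 -> int),
      [/\ admissible_ordering W s, forall k, bend (s k) = (b k)%:~R &
          forall k, (b k = bend_pattern eps k %[mod 4])%Z]].
Proof.
move=> [f [fM VE]] [bint [_ gcd1]].
have [k|c0] := configuration_exists fM.
  apply: bint; exists (act f (standard R k)) => //; exists V; first exact: family_start.
  by rewrite VE; exists (standard R k) => //; exists k.
rewrite -VE => V0; have fam W := family_configuration V0 bint (W := W).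
have bendE (b : int) : bends (packing V) b%:~R ->
    exists2 k : nat, (k < 8)%N & (b = c0 k %[mod 4])%Z.
  move=> [X [W /fam[g [c [[_ -> cE _] cc0]]] [_ [k _ <-] <-]] bE].
  exists k => //; rewrite -cc0 //; congr (_ %% _)%Z.
  by apply/eqP; rewrite -(eqr_int R) -bE cE.
have [_ _ _ /orthoplicial_classification[ev|[l [eps [lP epsE lc]]]]] := V0.
  (* If the bends of [V] are all even, 2 divides every bend of the packing, against primitivity. *)
  suff : (2 %| 1)%N by [].
  by apply: gcd1 => b /bendE[k /ev]; lia.
have ord W : Defs.family V W -> exists (s : 'I_8 -> osphere R) (b : 'I_8 -> int),
      [/\ admissible_ordering W s, forall k, bend (s k) = (b k)%:~R &
          forall k, (b k = bend_pattern eps k %[mod 4])%Z].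
  move=> /fam[g [c [cW cc0]]]; have [s [sW sE]] := configuration_ordering cW lP.
  exists s, (fun k => c (nth 0%N l k)); split=> // k.
  have [l8 _] := signed_permP lP.
  by rewrite cc0 ?l8 // lc.
exists eps; split=> //.
- move=> b /bendE[k k8 ->].
  have [p [p' _ pp'] pE] := signed_perm_bij lP.
  have <- : nth 0%N l (p' (Ordinal k8)) = k by rewrite -pE pp'.
  rewrite lc //; case: (p' _) => -[|[|[|[|[|[|[|[|//]]]]]]]] ? /=; case: epsE => ->; lia.
- have [s [b [[_ sV _] sE bE]]] := ord V (family_start V).
  exists (b (inord 2)); last by rewrite bE inordK.
  exists (s (inord 2)); last exact: sE.
  by exists V; [exact: family_start|rewrite -sV; exists (inord 2)].
Qed.

End Packing.

Theorem proposition5p1 (R : realType) (P : set (osphere R))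
    (hP : is_packing P) (hprim : primitive P) :
  exists eps : int, [/\ eps = 1 \/ eps = -1,
    (forall b : int, bends P b%:~R -> (b <> - eps %[mod 4])%Z) &
    forall V : set (osphere R), configuration_in P V ->
      exists (s : 'I_8 -> osphere R) (b : 'I_8 -> int),
        [/\ admissible_ordering V s,
            forall k, bend (s k) = (b k)%:~R &
            forall k, (b k = tnth [tuple 0; 0; eps; eps; 2; 2; eps; eps] k %[mod 4])%Z]].
Proof.
have [V0 V0p PE] := hP.
have := hprim; rewrite [in X in X -> _]PE =>
  /(primitive_packing_pattern V0p)[eps [epsE nb [b0 Pb0 b0E] _]].
rewrite -PE in nb Pb0; exists eps; split=> // V [W [Wp PW WV]].
have := hprim; rewrite [in X in X -> _]PW =>
  /(primitive_packing_pattern Wp)[eps' [epsE' nb' _ ordW]].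
(* The generator [W] may differ from [V0], but the bend [b0], congruent to [eps], must avoid the
   residue of [- eps']. *)
have <- : eps' = eps.
  rewrite -PW in nb'; have := nb' _ Pb0; rewrite b0E.
  by case: epsE epsE' => -> [] ->.
have [s [b [sV sE bE]]] := ordW V WV.
exists s, b; split=> // k; rewrite bE (tnth_nth 0).
by [].
Qed.
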